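(* Let $r>0$, $\Delta>0$, $C\ge 2$. For each identity $l\in\{1,\dots,C\}$, let the features of identity $l$ be distributed as a random vector $\boldsymbol{z}_l$ in $\mathbb{R}^n$ with $\|\boldsymbol{z}_l\|=r$, let $\boldsymbol{m}_l=\mathbb{E}[\boldsymbol{z}_l]\neq 0$, let $\tilde{\boldsymbol{m}}_l=r\,\boldsymbol{m}_l/\|\boldsymbol{m}_l\|$, and let $\boldsymbol{W}_l\in\mathbb{R}^n$ with $\|\boldsymbol{W}_l\|=r$ be the weight vector of identity $l$. Assume: (A1) there is a constant $\beta$ such that $\|\boldsymbol{m}_l\|=\beta$ for all $l=1,\dots,C$; (A2) $\boldsymbol{W}_l=\tilde{\boldsymbol{m}}_l$ for all $l=1,\dots,C$. Let $\epsilon>0$ be a (small) positive number. If $\mathbb{E}[L_{\mathrm{NPT}}(\boldsymbol{z}_i)]<\epsilon$ for every identity $i=1,\dots,C$, then $d(\boldsymbol{W}_i,\boldsymbol{W}_j)>\Delta-\epsilon$ for all $i,j=1,2,\dots,C$ with $i\neq j$.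
   Context: $d(\boldsymbol{x},\boldsymbol{y})=(\boldsymbol{x}-\boldsymbol{y})^T(\boldsymbol{x}-\boldsymbol{y})$ is the squared Euclidean distance on $\mathbb{R}^n$ and $\|\cdot\|$ is the Euclidean norm. For a feature $\boldsymbol{z}_i$ of identity $i$, a nearest-neighbour negative proxy $\boldsymbol{W}_n^{(i)}$ (depending on $\boldsymbol{z}_i$) is a weight vector $\boldsymbol{W}_j$ with $j\ne i$ such that $d(\boldsymbol{z}_i,\boldsymbol{W}_j)\le d(\boldsymbol{z}_i,\boldsymbol{W}_k)$ for all $k\neq i$. The proposed loss, with margin $\Delta>0$, is $$L_{\mathrm{NPT}}(\boldsymbol{z}_i)=\max\{0,\ d(\boldsymbol{z}_i,\boldsymbol{W}_i)-d(\boldsymbol{z}_i,\boldsymbol{W}_n^{(i)})+\Delta\}.$$ The expectation $\mathbb{E}[L_{\mathrm{NPT}}(\boldsymbol{z}_i)]$ is over the random feature $\boldsymbol{z}_i$ of identity $i$. *)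

(* Defs.v *)
From HB Require Import structures.
From mathcomp Require Import all_boot all_order all_algebra.
From mathcomp Require Import all_classical all_reals all_analysis.

Set Implicit Arguments.
Unset Strict Implicit.
Unset Printing Implicit Defensive.

Import Order.TTheory GRing.Theory Num.Theory.
Local Open Scope ring_scope.

Section Euclidean.
Context {R : realType} {n : nat}.
Implicit Types x y : 'cV[R]_n.

Definition sqdist x y : R := ((x - y)^T *m (x - y)) 0 0.

(* MathComp-Analysis equips matrices with the sup norm as `|x|, hence a
   separate Euclidean norm. *)
Definition enorm x : R := Num.sqrt ((x^T *m x) 0 0).

End Euclidean.

Section RandomVectors.
Context {d : measure_display} {T : measurableType d} {R : realType} {n : nat}.

(* Measurability for the Borel sigma-algebra of R^n, which is generated by the
   coordinate maps. *)
Definition random_vector (X : T -> 'cV[R]_n) : Prop :=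
  forall k, measurable_fun [set: T] (fun t => X t k 0).

(* [fine] sends infinite expectations to 0; this does not occur for almost
   surely bounded random vectors. *)
Definition mean (P : probability T R) (X : T -> 'cV[R]_n) : 'cV[R]_n :=
  \col_k fine 'E_P[fun t => X t k 0].

End RandomVectors.

Section NPTLoss.
Context {R : realType} {n C : nat}.
Implicit Types (W : 'I_C -> 'cV[R]_n) (i : 'I_C) (z w : 'cV[R]_n).

Definition nearest_negative_proxy W i z w : Prop :=
  exists j, [/\ j != i, w = W j &
    forall k, k != i -> sqdist z (W j) <= sqdist z (W k)].

(* [Wn z] is the nearest-neighbour negative proxy selected for [z]. *)
Definition npt_loss (Delta : R) W i (Wn : 'cV[R]_n -> 'cV[R]_n) z : R :=
  Num.max 0 (sqdist z (W i) - sqdist z (Wn z) + Delta).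

End NPTLoss.

(* Main.v *)
Require Import Defs.
From HB Require Import structures.
From mathcomp Require Import all_boot all_order all_algebra.
From mathcomp Require Import all_classical all_reals all_analysis.
From mathcomp Require Import ring lra.

Set Implicit Arguments.
Unset Strict Implicit.
Unset Printing Implicit Defensive.

Import Order.TTheory GRing.Theory Num.Theory.
Local Open Scope ring_scope.

(** The hinge dominates d(z, W_i) - d(z, W_j) + Delta, which for weights of equal
    norm is the affine function 2 <z, W_j - W_i> + Delta of the feature.  Taking
    expectations replaces z by m_i = (||m_i|| / r) W_i and turns this lower bound
    into Delta - (||m_i|| / r) d(W_i, W_j); finally ||m_i|| <= r because the
    features lie on the sphere of radius r. *)

Section InnerProduct.
Context {R : realType} {n : nat}.
Implicit Types x y u v : 'cV[R]_n.

Definition inner x y : R := (x^T *m y) 0 0.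

Lemma innerE x y : inner x y = \sum_k x k 0 * y k 0.
Proof. by rewrite /inner mxE; apply: eq_bigr => k _; rewrite mxE. Qed.

Lemma innerC x y : inner x y = inner y x.
Proof. by rewrite !innerE; apply: eq_bigr => k _; rewrite mulrC. Qed.

Lemma innerBr x u v : inner x (u - v) = inner x u - inner x v.
Proof. by rewrite /inner mulmxBr !mxE. Qed.

Lemma innerZl a x y : inner (a *: x) y = a * inner x y.
Proof. by rewrite /inner linearZ /= -scalemxAl mxE. Qed.

Lemma inner_ge0 x : 0 <= inner x x.
Proof. by rewrite innerE; apply: sumr_ge0 => k _; rewrite -expr2 sqr_ge0. Qed.

Lemma sqr_enorm x : enorm x ^+ 2 = inner x x.
Proof. by rewrite sqr_sqrtr // inner_ge0. Qed.

Lemma sqdistE x y : sqdist x y = inner x x - 2 * inner x y + inner y y.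
Proof.
rewrite /sqdist -/(inner (x - y) (x - y)) innerBr !(innerC (x - y)) !innerBr.
by rewrite (innerC y x); ring.
Qed.

Lemma coord_le_enorm x k : `|x k 0| <= enorm x.
Proof.
rewrite -sqrtr_sqr ler_wsqrtr // -/(inner x x) innerE (bigD1 k) //= -expr2.
by rewrite lerDl; apply: sumr_ge0 => l _; rewrite -expr2 sqr_ge0.
Qed.

(** Cauchy-Schwarz on a sphere: expand [inner (x - y) (x - y)] and [inner (x + y) (x + y)], both
    nonnegative. The sum is written [x - (-1) *: y] so that [sqdistE] expands it too. *)
Lemma inner_le_sqr x y r : enorm x = r -> enorm y = r -> `|inner x y| <= r ^+ 2.
Proof.
move=> xr yr.
have Hx : inner x x = r ^+ 2 by rewrite -sqr_enorm xr.
have Hy : inner y y = r ^+ 2 by rewrite -sqr_enorm yr.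
have := inner_ge0 (x - y); rewrite -[inner _ _]/(sqdist x y) sqdistE Hx Hy.
have := inner_ge0 (x - (-1) *: y); rewrite -[inner _ _]/(sqdist x ((-1) *: y)).
rewrite sqdistE !(innerC _ (-1 *: y)) !innerZl (innerC y (-1 *: y)) innerZl.
rewrite (innerC y x) Hx Hy ler_norml => H1 H2; apply/andP; split; lra.
Qed.

End InnerProduct.

(* No measurability of [f] or [g] is needed: this spares us the measurability of
   the loss, hence of the proxy selection. *)
Lemma expectation_le_ge0 d (T : measurableType d) (R : realType)
    (P : probability T R) (f g : T -> R) :
  (forall t, 0 <= f t) -> (forall t, g t <= f t) -> ('E_P[g] <= 'E_P[f])%E.
Proof.
move=> f0 gf; rewrite unlock integralE.
apply: (@le_trans _ _ (\int[P]_t ((EFin \o g)^\+ t))%E).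
  (* The integral of [g] is that of its positive part minus that of its negative part; the latter is
     dropped. *)
  by rewrite geeDl // oppe_le0; exact: integral_ge0.
rewrite !ge0_integralTE //.
(* Both integrals are now suprema over simple functions lying below the integrand, and any such
   function below the positive part of [g] is also below [f]. *)
apply: le_ereal_sup => _ [h /= hg <-]; exists h => // t.
apply: (le_trans (hg t)); rewrite funeposE /= maxEle.
by case: ifP => _; rewrite lee_fin.
Qed.

Section SphericalRandomVector.
Context {d : measure_display} {T : measurableType d} {R : realType} {n : nat}.
Variables (P : probability T R) (X : T -> 'cV[R]_n) (r : R).
Hypotheses (X_rv : random_vector X) (X_norm : {ae P, forall t, enorm (X t) = r}).

Lemma integrable_coord k : P.-integrable setT (fun t => (X t k 0)%:E).
Proof.
apply/integrableP; split; first exact/measurable_realfun.measurable_EFinP/X_rv.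
apply: (@le_lt_trans _ _ (`|r|%:E * P setT)%E).
  apply: integral_le_bound => //; first exact/measurable_realfun.measurable_EFinP/X_rv.
  apply: filterS X_norm => t <- _; rewrite lee_fin.
  exact: le_trans (coord_le_enorm _ _) (ler_norm _).
by rewrite probability_setT mule1 ltry.
Qed.

Lemma integrable_inner v : P.-integrable setT (fun t => (inner (X t) v)%:E).
Proof.
under eq_fun do rewrite innerE -sumEFin.
apply: integrable_sum => // k _; under eq_fun do rewrite EFinM.
exact/integrableZr/integrable_coord.
Qed.

Lemma expectation_inner v :
  ('E_P[fun t => inner (X t) v])%E = (inner (mean P X) v)%:E.
Proof.
rewrite unlock /=; under eq_integral do rewrite innerE -sumEFin.
rewrite integral_sum //; last first.
  move=> k; under eq_fun do rewrite EFinM.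
  exact/integrableZr/integrable_coord.
rewrite innerE -sumEFin; apply: eq_bigr => k _.
under eq_integral do rewrite EFinM.
rewrite integralZr //; last exact: integrable_coord.
(* Integrability makes the coordinate expectation finite, so [fine] in [mean] loses nothing. *)
rewrite mxE EFinM fineK unlock //.
exact/integrable_fin_num/integrable_coord.
Qed.

(** The integrand [inner (X t) v] is almost surely at most [r ^+ 2], and [P] has mass 1. With [v] a
    multiple of the mean, this bounds the norm of the mean. *)
Lemma inner_mean_le v : enorm v = r -> inner (mean P X) v <= r ^+ 2.
Proof.
move=> vr; rewrite -lee_fin -expectation_inner unlock.
have iX := integrable_inner v.
apply: (le_trans (lee_abs _)); apply: (le_trans (le_abse_integral _ _ _)) => //.
  by case/integrableP: iX.
rewrite -[leRHS]mule1 -(probability_setT P); apply: integral_le_bound => //.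
- by case/integrableP: iX.
- by rewrite lee_fin sqr_ge0.
- by apply: filterS X_norm => t tr _; rewrite lee_fin inner_le_sqr.
Qed.

Lemma expectation_affine_inner a b v :
  ('E_P[fun t => (a * inner (X t) v + b)%R])%E = (a * inner (mean P X) v + b)%:E.
Proof.
have iX := integrable_inner v.
rewrite unlock; under eq_integral do rewrite EFinD EFinM.
rewrite integralD //; first last.
- exact: (finite_measure_integrable_cst P b).
- exact: integrableZl.
rewrite integralZl // integral_cst //.
rewrite [X in (_ + _ * X)%E](probability_setT P) mule1 EFinD EFinM.
by rewrite -expectation_inner unlock.
Qed.

End SphericalRandomVector.

Theorem mainTheorem5 (R : realType) (n C : nat) (r Delta : R)
  (r_gt0 : 0 < r) (Delta_gt0 : 0 < Delta) (C_ge2 : (2 <= C)%N)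
  (d : 'I_C -> measure_display) (T : forall l : 'I_C, measurableType (d l))
  (P : forall l : 'I_C, probability (T l) R)
  (z : forall l : 'I_C, T l -> 'cV[R]_n)
  (z_rv : forall l : 'I_C, random_vector (z l))
  (z_norm : forall l : 'I_C, {ae P l, forall t, enorm (z l t) = r})
  (m_neq0 : forall l : 'I_C, mean (P l) (z l) != 0)
  (W : 'I_C -> 'cV[R]_n)
  (W_norm : forall l : 'I_C, enorm (W l) = r)
  (A1 : exists beta : R, forall l : 'I_C, enorm (mean (P l) (z l)) = beta)
  (A2 : forall l : 'I_C,
    W l = (r / enorm (mean (P l) (z l))) *: mean (P l) (z l))
  (Wn : 'I_C -> 'cV[R]_n -> 'cV[R]_n)
  (Wn_nearest : forall (i : 'I_C) (x : 'cV[R]_n),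
    nearest_negative_proxy W i x (Wn i x))
  (eps : R) (eps_gt0 : 0 < eps)
  (loss_lt : forall i : 'I_C,
    ('E_(P i)[fun t => npt_loss Delta W i (Wn i) (z i t)] < eps%:E)%E) :
  forall i j : 'I_C, i != j -> Delta - eps < sqdist (W i) (W j).
Proof.
move=> i j ij.
set m := mean (P i) (z i).
have Hw l : inner (W l) (W l) = r ^+ 2 by rewrite -sqr_enorm W_norm.
(* If [enorm m] were 0, then, since [0^-1 = 0], A2 would give [W i = 0], against its norm
   [r > 0]. *)
have b0 : 0 < enorm m.
  rewrite lt_neqAle sqrtr_ge0 andbT eq_sym; apply/eqP => b0.
  have := Hw i; rewrite A2 -/m b0 invr0 mulr0 innerZl mul0r => /esym/eqP.
  by rewrite sqrf_eq0 gt_eqF.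
(* A2 inverted: [m] is [enorm m / r] times [W i]. *)
have mW v : inner m v = enorm m / r * inner (W i) v.
  rewrite A2 innerZl -/m mulrA [_ / _ * _](_ : _ = 1) ?mul1r //.
  by field; rewrite !gt_eqF.
have b_le : enorm m / r <= 1.
  have := inner_mean_le (z_rv i) (z_norm i) (W_norm i); rewrite -/m mW Hw.
  by rewrite -[leRHS]mul1r ler_pM2r // exprn_gt0.
have hinge : ('E_(P i)[fun t => (2 * inner (z i t) (W j - W i) + Delta)%R] <=
    'E_(P i)[fun t => npt_loss Delta W i (Wn i) (z i t)])%E.
  apply: expectation_le_ge0 => t; rewrite /npt_loss le_max ?lexx //.
  (* The proxy is no farther from the feature than [W j], so putting [W j] in its place can only
     lower the loss. *)
  have [k [_ -> /(_ j)]] := Wn_nearest i (z i t).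
  rewrite eq_sym => /(_ ij); rewrite innerBr !sqdistE !Hw => kj.
  by apply/orP; right; lra.
have := le_lt_trans hinge (loss_lt i).
rewrite (expectation_affine_inner (z_rv i) (z_norm i)) lte_fin -/m mW innerBr Hw.
(* The expected lower bound is [Delta - enorm m / r * sqdist (W i) (W j)]; as the factor is at most
   1 and the distance nonnegative, the factor can be removed. *)
have : enorm m / r * sqdist (W i) (W j) <= sqdist (W i) (W j).
  by rewrite ler_piMl // /sqdist inner_ge0.
by rewrite sqdistE !Hw; lra.
Qed.
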